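(* Assume the temperature $T>0$ is constant in time. Let $f=f(x,t)$, $x\in\mathbb{R}^d$, $t\ge 0$, be a solution (a probability density in $x$ for each $t$) of the linear kinetic equation $$\frac{\partial f(x,t)}{\partial t}=\mathbb{E}_\xi\big[B(x'\to x)f(x',t)-B(x\to x')f(x,t)\big],\qquad x'=x+\sigma(t)\xi .$$ Then the functional $$H(f|f^\infty)=\int_{\mathbb{R}^d} f(x,t)\log\left(\frac{f(x,t)}{f^\infty(x)}\right)dx$$ satisfies $$\frac{d H(f|f^\infty)}{dt}=-I[f]\le 0,$$ where $$I[f]=\frac12\,\mathbb{E}_\xi\left[\int_{\mathbb{R}^d}B(x\to x')\,f^\infty(x)\,h\left(\frac{f(x',t)}{f^\infty(x')},\frac{f(x,t)}{f^\infty(x)}\right)dx\right],$$ and $h(a,b)=(a-b)(\log a-\log b)$ for $a,b>0$.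
   Context: $F:\mathbb{R}^d\to\mathbb{R}$ is a given cost function (its minimizer exists and is unique). For temperature $T>0$, the Boltzmann-Gibbs distribution is $f^\infty(x)=C e^{-F(x)/T}$ with $C$ the constant normalizing $f^\infty$ to a probability density on $\mathbb{R}^d$. $p$ is a probability density on $\mathbb{R}^d$ which is symmetric, $p(-\xi)=p(\xi)$, with mean $0$ and identity covariance matrix, and $\mathbb{E}_\xi[g]=\int_{\mathbb{R}^d}g(\xi)p(\xi)\,d\xi$. $\sigma(t)>0$ is a given function of time and $x'=x+\sigma(t)\xi$. The transition probability is $$B(x\to x')=\min\left\{1,\frac{f^\infty(x')}{f^\infty(x)}\right\},$$ and correspondingly $B(x'\to x)=\min\{1,f^\infty(x)/f^\infty(x')\}$.
   Formalization: Adds that f is everywhere positive and that, for every t ≥ 0, f log(f/f^∞) is integrable in x and Lipschitz in time at t with an integrable constant; without such regularity H can be infinite for all t (e.g. Cauchy initial data with Gaussian f^∞). *)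

(* Defs.v *)
From HB Require Import structures.
From mathcomp Require Import all_boot all_order all_algebra.
From mathcomp Require Import all_classical all_reals all_analysis.

Set Implicit Arguments.
Unset Strict Implicit.
Unset Printing Implicit Defensive.

Import Order.TTheory GRing.Theory Num.Theory.
Import numFieldNormedType.Exports.

Local Open Scope classical_set_scope.
Local Open Scope ring_scope.

(* R^d is 'rV[R]_d with the product sigma-algebra (the one generated by the
   coordinates, as for n.-tuple in the library) and the Lebesgue measure
   obtained by iterating the binary product measure. *)

Section measurable_rV.
Context {d} {T : measurableType d}.
Variable n : nat.

Let coors : 'I_n -> 'rV[T]_n -> T := fun i v => v ord0 i.

Let rV_set0 : g_sigma_preimage coors set0.
Proof. exact: sigma_algebra0. Qed.

Let rV_setC A : g_sigma_preimage coors A -> g_sigma_preimage coors (~` A).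
Proof. exact: sigma_algebraC. Qed.

Let rV_bigcup (F : _^nat) : (forall i, g_sigma_preimage coors (F i)) ->
  g_sigma_preimage coors (\bigcup_i (F i)).
Proof. exact: sigma_algebra_bigcup. Qed.

HB.instance Definition _ := @isMeasurable.Build (measure_tuple_display d)
  'rV[T]_n (g_sigma_preimage coors) rV_set0 rV_setC rV_bigcup.

Lemma measurable_rV_coord (i : 'I_n) :
  measurable_fun [set: 'rV[T]_n] (fun v => v ord0 i).
Proof.
move=> _ Y mY; rewrite setTI; apply: sub_sigma_algebra => /=.
rewrite -bigcup_seq/=; exists i => /=; first by rewrite mem_index_enum.
by exists Y => //; rewrite setTI.
Qed.

Lemma measurable_fun_rVP d1 (T1 : measurableType d1) (f : T1 -> 'rV[T]_n) :
  (forall i, measurable_fun [set: T1] (fun x => f x ord0 i)) ->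
  measurable_fun [set: T1] f.
Proof.
move=> mf _ A mA; rewrite setTI.
have : preimage_set_system [set: T1] f (g_sigma_preimage coors) `<=` measurable.
  rewrite -g_sigma_preimage_comp.
  apply: smallest_sub; first exact: sigma_algebra_measurable.
  rewrite -bigcup_seq; apply: bigcup_sub => i _ B [C mC <-].
  exact: (mf i).
by apply; exists A => //; rewrite setTI.
Qed.

End measurable_rV.

Section lebesgue_rV.
Context {R : realType}.
Local Notation V n := 'rV[R]_n.

Definition cons_rV n (x : measurableTypeR R * V n) : V n.+1 :=
  \row_i (if unlift ord0 i is Some j then x.2 ord0 j else x.1).

Let uncons_rV n (v : V n.+1) : measurableTypeR R * V n :=
  (v ord0 ord0, \row_j v ord0 (lift ord0 j)).

Let cons_rVK n : cancel (@cons_rV n) (@uncons_rV n).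
Proof.
move=> [a v]; congr pair; first by rewrite mxE unlift_none.
by apply/rowP => j; rewrite !mxE liftK.
Qed.

Lemma measurable_cons_rV n : measurable_fun setT (@cons_rV n).
Proof.
apply: measurable_fun_rVP => i.
under eq_fun do rewrite mxE.
case: unliftP => [j _|_]; last exact: measurable_fst.
exact: (measurableT_comp (measurable_rV_coord j) measurable_snd).
Qed.

Let measurable_uncons_rV n : measurable_fun setT (@uncons_rV n).
Proof.
apply/measurable_fun_pair => //=; first exact: measurable_rV_coord.
apply: measurable_fun_rVP => i.
by under eq_fun do rewrite mxE; exact: measurable_rV_coord.
Qed.

Section step.
Variables (n : nat) (mu : {sigma_finite_measure set (V n) -> \bar R}).

Definition lebesgue_rV_step : set (V n.+1) -> \bar R :=
  pushforward (lebesgue_measure \x mu)%E (@cons_rV n).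

Let step0 : lebesgue_rV_step set0 = 0%E.
Proof. by rewrite /lebesgue_rV_step /pushforward preimage_set0 measure0. Qed.

Let step_ge0 A : (0 <= lebesgue_rV_step A)%E.
Proof. by rewrite /lebesgue_rV_step /pushforward measure_ge0. Qed.

Let step_sigma_additive : semi_sigma_additive lebesgue_rV_step.
Proof.
move=> F mF tF mUF; rewrite /lebesgue_rV_step /pushforward preimage_bigcup.
apply: measure_semi_sigma_additive.
- by move=> k; rewrite -[X in measurable X]setTI; exact: measurable_cons_rV.
- apply/trivIsetP => /= i j _ _ ij; rewrite -preimage_setI.
  by move/trivIsetP : tF => /(_ _ _ _ _ ij) ->//; rewrite preimage_set0.
- rewrite -preimage_bigcup -[X in measurable X]setTI.
  exact: measurable_cons_rV.
Qed.

HB.instance Definition _ := isMeasure.Build _ _ _ lebesgue_rV_step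
  step0 step_ge0 step_sigma_additive.

Let step_sigma_finite : sigma_finite setT lebesgue_rV_step.
Proof.
have /sigma_finiteP[F [FT ndF Foo]] := sigma_finiteT (@lebesgue_measure R).
have /sigma_finiteP[G [GT ndG Goo]] := sigma_finiteT mu.
exists (fun k => @uncons_rV n @^-1` (F k `*` G k)).
  rewrite -preimage_bigcup -[LHS](preimage_setT (@uncons_rV n)); congr preimage.
  apply/esym/seteqP; split=> // -[x y] _.
  have [i _ Fix] : (\bigcup_i F i) x by rewrite -FT.
  have [j _ Gjy] : (\bigcup_i G i) y by rewrite -GT.
  exists (maxn i j) => //; split => /=.
  - by move: x Fix; exact/subsetPset/ndF/leq_maxl.
  - by move: y Gjy; exact/subsetPset/ndG/leq_maxr.
move=> k; have [mF Fk] := Foo k; have [mG Gk] := Goo k; split.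
  rewrite -[X in measurable X]setTI; apply: measurable_uncons_rV => //.
  exact: measurableX.
rewrite /lebesgue_rV_step /pushforward -comp_preimage.
rewrite (_ : _ \o _ = id) ?preimage_id; last first.
  by apply/funext => x /=; rewrite cons_rVK.
rewrite [ltLHS]product_measure1E//.
by rewrite lte_mul_pinfty// ge0_fin_numE.
Qed.

HB.instance Definition _ := Measure_isSigmaFinite.Build _ _ _ lebesgue_rV_step
  step_sigma_finite.

End step.

Fixpoint lebesgue_rV n : {sigma_finite_measure set (V n) -> \bar R} :=
  match n return {sigma_finite_measure set (V n) -> \bar R} with
  | 0 => @dirac _ (V 0) 0 R
  | m.+1 => lebesgue_rV_step (lebesgue_rV m)
  end.

Lemma lebesgue_rV_box n (A : 'I_n -> set R) :
  (forall i, measurable (A i)) ->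
  lebesgue_rV n [set v | forall i, A i (v ord0 i)] =
  (\prod_(i < n) lebesgue_measure (A i))%E.
Proof.
elim: n A => [|n IH] A mA.
  rewrite big_ord0 /= diracE mem_set//= => -[].
  by case.
pose B := [set v : V n | forall i, A (lift ord0 i) (v ord0 i)].
have mB : measurable B.
  rewrite (_ : B = \bigcap_(i in [set: 'I_n])
      ((fun v : V n => v ord0 i) @^-1` A (lift ord0 i))).
    apply: fin_bigcap_measurable => // i _; rewrite -[X in measurable X]setTI.
    exact: measurable_rV_coord.
  by apply/seteqP; split => v /= H i; [move=> _|]; exact: H.
rewrite big_ord_recl -IH//= -/B -[RHS]product_measure1E//; last exact: mA.
rewrite /lebesgue_rV_step /pushforward.
congr (_ _); apply/seteqP; split=> [[a v] /= H|[a v] /= [Ha Hv] i].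
  split=> [|i]; first by have := H ord0; rewrite mxE unlift_none.
  by have := H (lift ord0 i); rewrite mxE liftK.
by rewrite mxE; case: unliftP => [j ->|->].
Qed.

End lebesgue_rV.

(* Derivative at t of a function of time t >= 0: the increments are restricted
   to [0, +oo[, so it is one-sided at t = 0. *)
Definition is_derive_nneg (R : realType) (g : R -> R) (t l : R) : Prop :=
  (fun s => (g s - g t) / (s - t)) @ within [set s | 0 <= s] t^' --> l.

Lemma is_derive_nnegE (R : realType) (g : R -> R) (t l : R) : 0 < t ->
  is_derive_nneg g t l <-> is_derive t 1 g l.
Proof.
move=> t0; rewrite /is_derive_nneg.
have -> : within [set s | 0 <= s] t^' = t^'.
  apply/seteqP; split => A /=; rewrite /within /=; last first.
    by apply: filterS => x + _.
  move=> nA.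
  have : \forall s \near t^', 0 <= s.
    by apply: nbhs_dnbhs; near do rewrite ltW//; exact: lt_nbhsr.
  by move: nA; apply: filterS2 => s; apply.
have -> : (fun s => (g s - g t) / (s - t)) @ t^' =
          (fun h => h^-1 *: (g (h *: 1 + t) - g t)) @ 0^'.
  apply/funext => A.
  change ((\forall s \near t, s != t -> A ((g s - g t) / (s - t))) =
    (\forall h \near 0, h != 0 -> A (h^-1 *: (g (h *: 1 + t) - g t)))).
  rewrite [LHS](near_shift 0); congr nbhs.
  apply/funext => h /=; rewrite subr0 addrK -subr_eq0 addrK.
  by rewrite /GRing.scale /= mulr1 mulrC.
split=> [gl|[gt <-]]; last exact: gt.
by split; [apply/cvg_ex; exists l|exact: cvg_lim].
Unshelve. all: by end_near. Qed.

Section kinetic.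
Context {R : realType} {d : nat}.
Local Notation V := 'rV[R]_d.
Local Notation mu := (lebesgue_rV d).
Implicit Types (finf g p F : V -> R) (f : V -> R -> R) (sigma : R -> R).

Definition is_density g : Prop :=
  [/\ measurable_fun [set: V] g, forall x, 0 <= g x
    & (\int[mu]_x (g x)%:E = 1)%E].

Definition gibbs F (T C : R) (x : V) : R := C * expR (- F x / T).

(* E_xi[g]; since +oo - +oo = -oo in \bar R, a finite value means that the
   (measurable) integrand is integrable. *)
Definition expect p (g : V -> \bar R) : \bar R :=
  (\int[mu]_xi (g xi * (p xi)%:E))%E.

Definition mean0 p : Prop :=
  forall i : 'I_d, expect p (fun xi => (xi ord0 i)%:E) = 0%E.

Definition covariance_id p : Prop :=
  forall i j : 'I_d,
    expect p (fun xi => (xi ord0 i * xi ord0 j)%:E) = ((i == j)%:R)%:E.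

(* B(x -> x') *)
Definition transition finf (x x' : V) : R := Num.min 1 (finf x' / finf x).

(* right-hand side of the kinetic equation, for the density g and jump size s *)
Definition collision finf p (s : R) g (x : V) : \bar R :=
  expect p (fun xi => let x' := x + s *: xi in
    (transition finf x' x * g x' - transition finf x x' * g x)%:E).

Definition kinetic_solution finf p sigma f : Prop :=
  forall t, 0 <= t ->
    is_density (f^~ t) /\
    forall x, collision finf p (sigma t) (f^~ t) x \is a fin_num /\
      is_derive_nneg (f x) t (fine (collision finf p (sigma t) (f^~ t) x)).

Definition entropy_density finf g (x : V) : R := g x * ln (g x / finf x).

Definition relative_entropy finf g : R := \int[mu]_x entropy_density finf g x.

(* The regularity in time under which the entropy is finite and may be
   differentiated under the integral sign: the integrand is Lipschitz in time
   at every t >= 0, with an integrable constant. *)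
Definition entropy_regular finf f : Prop :=
  forall t, 0 <= t ->
    mu.-integrable setT (EFin \o entropy_density finf (f^~ t)) /\
    exists2 G : V -> R, mu.-integrable setT (EFin \o G) &
      \forall s \near t, 0 <= s -> {ae mu, forall x,
        `|entropy_density finf (f^~ s) x - entropy_density finf (f^~ t) x|
          <= G x * `|s - t|}.

Definition hfun (a b : R) : R := (a - b) * (ln a - ln b).

(* I[g], an integral of a nonnegative function, with values in [0, +oo] *)
Definition entropy_production finf p (s : R) g : \bar R :=
  ((2^-1)%:E * expect p (fun xi =>
    \int[mu]_x (let x' := (x + s *: xi)%R in
      transition finf x x' * finf x *
        hfun (g x' / finf x') (g x / finf x))%:E))%E.

End kinetic.

(* Main.v *)
Require Import Defs.
From HB Require Import structures.
From mathcomp Require Import all_boot all_order all_algebra.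
From mathcomp Require Import all_classical all_reals all_analysis.
From mathcomp Require Import measurable_realfun ring lra.

Import Order.TTheory GRing.Theory Num.Theory.
Import numFieldNormedType.Exports.

Local Open Scope classical_set_scope.
Local Open Scope ring_scope.

(* Write m for the Gibbs density, u = f / m and K = min (m x) (m x') p(xi); then
   B(x -> x') m(x) p(xi) = K, and the collision term is the integral over xi of
   K (u(x') - u(x)).  The change of variables (x, xi) -> (x + sigma xi, -xi)
   preserves Lebesgue measure, exchanges x and x', and leaves K invariant, hence
   the weak form 2 int L Q = - int int K (u' - u) (L' - L) of the collision term
   Q for bounded L.  The integrand of dH/dt is (ln u + 1) Q, which the Lipschitz
   bound makes integrable, while Q is integrable with integral 0; so ln u Q is
   integrable too.  The weak form is then applied to the truncations of ln u:
   the left-hand side converges by domination, and the right-hand side by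
   monotonicity, since the increments of u and of clamped ln u have the same
   sign and those of clamped ln u grow with the truncation level. *)

(** * Invariance of the Lebesgue measure *)

Section lebesgue_rV_invariance.
Context {R : realType}.
Local Notation V n := 'rV[R]_n.
Local Notation leb := (@lebesgue_measure R).

(** By uniqueness of the Lebesgue measure it is enough to compare lengths of half-open intervals,
    and shifting both endpoints keeps the length. *)
Lemma lebesgue_measure_preimageDr (c : R) (A : set R) : measurable A ->
  leb ((fun x : R => x + c) @^-1` A) = leb A.
Proof.
move=> mA.
have mf : measurable_fun setT (fun x : R => x + c : measurableTypeR R).
  by apply: measurable_funD => //; exact: measurable_cst.
pose mF : {mfun measurableTypeR R >-> measurableTypeR R} :=
  HB.pack (fun x : R => x + c) (isMeasurableFun.Build _ _
    (measurableTypeR R) (measurableTypeR R) _ mf).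
apply/esym; rewrite -[RHS]/(pushforward leb mF A).
apply: lebesgue_measure_unique => //= _ [[a b]] _ <-.
rewrite /pushforward.
have -> : mF @^-1` `]a, b] = `](a - c), (b - c)]%classic.
  by apply/seteqP; split => x /=; rewrite !in_itv/= ltrBlDr lerBrDr.
rewrite !lebesgue_measure_itv/= !lte_fin ltrD2r -!EFinB.
by rewrite (_ : b - c - (a - c) = b - a)//; ring.
Qed.

Lemma ge0_integral_lebesgue_rV_cons n (h : V n.+1 -> \bar R) :
  measurable_fun setT h -> (forall v, 0 <= h v)%E ->
  (\int[lebesgue_rV n.+1]_v h v =
   \int[leb]_a \int[lebesgue_rV n]_v h (cons_rV (a, v)))%E.
Proof.
move=> mh h0.
have mc := @measurable_cons_rV R n.
rewrite [LHS](ge0_integral_pushforward mc)//.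
rewrite preimage_setT fubini_tonelli1//; last by move=> x; exact: h0.
exact: measurableT_comp mh mc.
Qed.

(** Translations and reflections both act coordinate by coordinate, so one induction on the
    dimension serves both. Tonelli separates the first coordinate: the inner integral falls to the
    induction hypothesis, the outer one to the equality of the pushforward under [phi ord0] with the
    Lebesgue measure. The family [phi] may vary with the coordinate because a translation vector
    does. *)
Lemma ge0_integral_lebesgue_rV_map n (phi : 'I_n -> R -> R) :
  (forall i, measurable_fun setT (phi i)) ->
  (forall i (A : set R), measurable A -> leb (phi i @^-1` A) = leb A) ->
  forall h : V n -> \bar R, measurable_fun setT h -> (forall v, 0 <= h v)%E ->
  (\int[lebesgue_rV n]_v h (\row_i phi i (v ord0 i)) =
   \int[lebesgue_rV n]_v h v)%E.
Proof.
elim: n phi => [|n IH] phi mphi phiL h mh h0.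
  apply: eq_integral => v _; congr h.
  by apply/rowP => -[].
have mrow k (psi : 'I_k -> R -> R) : (forall i, measurable_fun setT (psi i)) ->
    measurable_fun [set: V k] (fun v : V k => \row_i psi i (v ord0 i)).
  move=> mpsi; apply: measurable_fun_rVP => i.
  under eq_fun do rewrite mxE.
  exact: (measurableT_comp (mpsi i) (measurable_rV_coord i)).
rewrite !ge0_integral_lebesgue_rV_cons//; last first.
  exact: measurableT_comp mh (mrow _ _ mphi).
pose H (a : R) := (\int[lebesgue_rV n]_v h (cons_rV (a, v)))%E.
have mH : measurable_fun setT H.
  apply: (measurable_fun_fubini_tonelli_F (fun x => h (cons_rV x))) => //.
  exact: measurableT_comp mh (@measurable_cons_rV R n).
have H0 a : (0 <= H a)%E by exact: integral_ge0.
transitivity (\int[leb]_a H (phi ord0 a))%E.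
  apply: eq_integral => a _.
  apply: etrans (IH (fun i => phi (lift ord0 i)) (fun i => mphi _)
    (fun i => phiL _) (fun v => h (cons_rV (phi ord0 a, v))) _ _) => //.
    apply: eq_integral => v _; congr h; apply/rowP => i.
    by rewrite !mxE; case: unliftP => [j ->|->]; rewrite ?mxE.
  apply: measurableT_comp mh _.
  exact: measurableT_comp (@measurable_cons_rV R n) (pair1_measurable _).
have := @ge0_integral_pushforward _ _ (measurableTypeR R) (measurableTypeR R) R
  _ (mphi ord0) leb _ H measurableT (measurable_funTS mH)
  (in1W (fun a => H0 a)).
rewrite preimage_setT => <-.
apply: eq_measure_integral => [|? A mA _]; [exact: mphi|exact: phiL].
Qed.

Lemma ge0_integral_lebesgue_rVD n (c : V n) (h : V n -> \bar R) :
  measurable_fun setT h -> (forall v, 0 <= h v)%E ->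
  (\int[lebesgue_rV n]_v h (v + c)%R = \int[lebesgue_rV n]_v h v)%E.
Proof.
move=> mh h0.
rewrite -[RHS](ge0_integral_lebesgue_rV_map n (fun i x => x + c ord0 i))//.
- by apply: eq_integral => v _; congr h; apply/rowP => i; rewrite !mxE.
- by move=> i; apply: measurable_funD => //; exact: measurable_cst.
- by move=> i A; exact: lebesgue_measure_preimageDr.
Qed.

Lemma ge0_integral_lebesgue_rVN n (h : V n -> \bar R) :
  measurable_fun setT h -> (forall v, 0 <= h v)%E ->
  (\int[lebesgue_rV n]_v h (- v)%R = \int[lebesgue_rV n]_v h v)%E.
Proof.
move=> mh h0; rewrite -[RHS](ge0_integral_lebesgue_rV_map n (fun=> -%R))//.
- by apply: eq_integral => v _; congr h; apply/rowP => i; rewrite !mxE.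
- by move=> i A; exact: lebesgue_measureN.
Qed.

Lemma measurable_rVD d (T : measurableType d) n (f g : T -> V n) :
  measurable_fun setT f -> measurable_fun setT g ->
  measurable_fun setT (fun x => f x + g x).
Proof.
move=> mf mg; apply: measurable_fun_rVP => i.
under eq_fun do rewrite mxE.
by apply: measurable_funD;
  [exact: (measurableT_comp (measurable_rV_coord i) mf)
  |exact: (measurableT_comp (measurable_rV_coord i) mg)].
Qed.

Lemma measurable_rVZ d (T : measurableType d) n (a : R) (f : T -> V n) :
  measurable_fun setT f -> measurable_fun setT (fun x => a *: f x).
Proof.
move=> mf; apply: measurable_fun_rVP => i.
under eq_fun do rewrite mxE.
apply: measurable_funM; first exact: measurable_cst.
exact: (measurableT_comp (measurable_rV_coord i) mf).
Qed.

Lemma measurable_rVN n : measurable_fun setT (-%R : V n -> V n).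
Proof.
have -> : (-%R : V n -> V n) = (fun v => -1 *: v).
  by apply/funext => v; rewrite scaleN1r.
exact: measurable_rVZ.
Qed.

End lebesgue_rV_invariance.

(** * Reversal of a jump *)

Section jump_swap.
Context {R : realType} {d : nat}.
Local Notation V := 'rV[R]_d.
Local Notation mu := (lebesgue_rV d).
Variable s : R.

Definition jump_swap (z : V * V) : V * V := (z.1 + s *: z.2, - z.2).

Lemma measurable_jump : measurable_fun setT (fun z : V * V => z.1 + s *: z.2).
Proof. by apply: measurable_rVD => //; exact: measurable_rVZ. Qed.

Lemma measurable_jump_swap : measurable_fun setT jump_swap.
Proof.
apply/measurable_fun_pair => //=; first exact: measurable_jump.
exact: measurableT_comp (@measurable_rVN R d) measurable_snd.
Qed.

(** For fixed noise the map is a translation in the position, and what remains is a reflection of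
    the noise. Tonelli with the position innermost treats the two in turn. *)
Lemma ge0_integral_jump_swap (h : V * V -> \bar R) :
  measurable_fun setT h -> (forall z, 0 <= h z)%E ->
  (\int[mu \x mu]_z h (jump_swap z) = \int[mu \x mu]_z h z)%E.
Proof.
move=> mh h0.
rewrite fubini_tonelli2//; last exact: measurableT_comp mh measurable_jump_swap.
pose H (xi : V) := (\int[mu]_x h (x, xi))%E.
rewrite [RHS]fubini_tonelli2// -[RHS]/(\int[mu]_xi H xi)%E.
have mH : measurable_fun setT H by exact: measurable_fun_fubini_tonelli_G.
rewrite -(ge0_integral_lebesgue_rVN _ H mH); last first.
  by move=> v; exact: integral_ge0.
apply: eq_integral => xi _; rewrite /H.
rewrite -(ge0_integral_lebesgue_rVD _ (s *: xi) (fun x => h (x, - xi)%R))//.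
exact: measurableT_comp mh (pair2_measurable _).
Qed.

Lemma integral_jump_swap (h : V * V -> \bar R) : measurable_fun setT h ->
  (\int[mu \x mu]_z h (jump_swap z) = \int[mu \x mu]_z h z)%E.
Proof.
move=> mh; rewrite integralE [RHS]integralE; congr (_ - _)%E.
- rewrite -[RHS]ge0_integral_jump_swap//; last exact: measurable_funepos.
  by apply: eq_integral => z _; rewrite !funeposE.
- rewrite -[RHS]ge0_integral_jump_swap//; last exact: measurable_funeneg.
  by apply: eq_integral => z _; rewrite !funenegE.
Qed.

End jump_swap.

(** * Derivatives in time *)

Section derive_nneg.
Context {R : realType}.
Implicit Types (g h : R -> R) (t l : R) (u : R^nat).

Local Notation time_nbhs t := (within [set s : R | 0 <= s] t^').

Lemma time_nbhs_cvg t u : (forall n, 0 <= u n /\ u n != t) ->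
  u @ \oo --> t -> u @ \oo --> time_nbhs t.
Proof.
move=> u0 ut A; rewrite /within /= => nA.
have {}nA : \forall s \near t, s != t -> 0 <= s -> A s by [].
have : \forall n \near \oo, u n != t -> 0 <= u n -> A (u n) := ut _ nA.
apply: filterS => n An.
by have [un0 unt] := u0 n; exact: An.
Qed.

(** Dominated convergence speaks of sequences, so limits in continuous time are reduced to them. If
    the limit failed for some [e], choosing a bad time within [n.+1%:R^-1] of [t] for each [n] would
    give a sequence contradicting the assumption. *)
Lemma time_nbhs_seqP t l h :
  (forall u, (forall n, 0 <= u n /\ u n != t) -> u @ \oo --> t ->
    (h \o u) @ \oo --> l) ->
  h @ time_nbhs t --> l.
Proof.
move=> hu; apply: contrapT => hl.
have [e e0 He] : exists2 e : R, 0 < e &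
    forall d : R, 0 < d -> exists s, [/\ `|t - s| < d, s != t, 0 <= s &
      e <= `|l - h s|].
  apply: contrapT => He; apply: hl; apply/cvgrPdist_lt => e e0.
  have [d Hd] : exists d : R, 0 < d /\
      forall s, `|t - s| < d -> s != t -> 0 <= s -> `|l - h s| < e.
    apply: contrapT => Hd; apply: He; exists e => // d d0.
    apply: contrapT => Hs; apply: Hd; exists d; split=> // s sd st s0.
    by rewrite ltNge; apply/negP => el; apply: Hs; exists s.
  case: Hd => d0 Hd.
  rewrite /within /= /prop_near1 /nbhs /=.
  by exists d => //= s /= sd st s0; exact: Hd.
have H n : exists s,
    [/\ `|t - s| < n.+1%:R^-1, s != t, 0 <= s & e <= `|l - h s|].
  by apply: He; rewrite invr_gt0.
have [u Hu] := choice H.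
have ut : u @ \oo --> t.
  apply/cvgrPdist_lt => r r0; near=> n.
  have [un _ _ _] := Hu n; apply: lt_le_trans un _.
  apply: ltW; near: n; exact: (near_infty_natSinv_lt (PosNum r0)).
have := hu u (fun n => let: And4 _ a b _ := Hu n in conj b a) ut.
move=> /cvgrPdist_lt/(_ e e0)[N _ /(_ N (leqnn N))] /=.
by have [_ _ _ ] := Hu N; rewrite ltNge => ->.
Unshelve. all: by end_near. Qed.

(** Near [t], [g s] is [g t] plus the slope times [s - t], and that product tends to [l * 0]. *)
Lemma is_derive_nneg_continuous g t l : is_derive_nneg g t l ->
  g @ time_nbhs t --> g t.
Proof.
move=> gl; rewrite -[X in _ --> X](addr0 (g t)) -[X in g t + X](mulr0 l).
have st : (fun s => s - t) @ time_nbhs t --> (0 : R).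
  rewrite -(subrr t); apply: cvgB; last exact: cvg_cst.
  by move=> A tA; do 2 apply: cvg_within.
apply: cvg_trans (cvgD (cvg_cst (g t)) (cvgM gl st)).
apply: near_eq_cvg.
have E : \forall s \near t, s != t -> 0 <= s ->
    g t + (g s - g t) / (s - t) * (s - t) = g s.
  by exists 1 => //= s _ st' _; rewrite divfK ?subr_eq0// addrC subrK.
exact: E.
Qed.

(* Caratheodory's form of differentiability: the slope of [psi] at [g t],
   completed by its derivative, is continuous there. *)
Lemma is_derive_nneg_comp g t l (psi : R -> R) (dpsi : R) :
  is_derive_nneg g t l -> is_derive (g t) 1 psi dpsi ->
  is_derive_nneg (psi \o g) t (dpsi * l).
Proof.
move=> gl psi_der.
pose q (y : R) := if y == g t then dpsi else (psi y - psi (g t)) / (y - g t).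
have psiE y : psi y - psi (g t) = q y * (y - g t).
  rewrite /q; case: eqP => [->|/eqP yt]; first by rewrite !subrr mulr0.
  by rewrite divfK// subr_eq0.
have qc : q @ nbhs (g t) --> dpsi.
  have : (fun k : R => k^-1 *: (psi (k *: 1 + g t) - psi (g t))) @ 0^' --> dpsi.
    by have [/cvg_ex[/= a pa] <-] := psi_der; rewrite /derive (cvg_lim _ pa).
  move=> /cvgrPdist_lt dq; apply/cvgrPdist_lt => e e0.
  have := dq e e0; rewrite /within /= => -[d /= d0 Hd].
  exists d => //= y /= yd; rewrite /q; case: eqP => [|/eqP yt].
    by rewrite subrr normr0.
  have := Hd (y - g t); rewrite /ball /= sub0r normrN distrC.
  move=> /(_ yd); rewrite subr_eq0 => /(_ yt).
  by rewrite /GRing.scale /= mulr1 subrK mulrC.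
have qg : (q \o g) @ time_nbhs t --> dpsi.
  by apply: cvg_comp qc; exact: is_derive_nneg_continuous gl.
rewrite /is_derive_nneg.
under eq_fun do rewrite /= psiE -mulrA.
exact: cvgM.
Qed.

End derive_nneg.

(** * Differentiation under the integral sign *)

Section derive_under_integral.
Context {R : realType} {disp : measure_display} {X : measurableType disp}.
Variable mu : {measure set X -> \bar R}.
Variables (phi : X -> R -> R) (D G : X -> R) (t : R).
Hypothesis t_ge0 : 0 <= t.
Hypothesis phi_int : forall s, 0 <= s -> mu.-integrable setT (EFin \o phi^~ s).
Hypothesis phi_derive : forall x, is_derive_nneg (phi x) t (D x).
Hypothesis G_int : mu.-integrable setT (EFin \o G).
Hypothesis phi_lip : \forall s \near t, 0 <= s -> {ae mu, forall x,
  `|phi x s - phi x t| <= G x * `|s - t|}.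

(** Dominated convergence for the difference quotients, with [G] as dominating function.
    Integrability of the pointwise limit [D] comes out as a conclusion. *)
Let quot_cvg (u : R^nat) : (forall n, 0 <= u n /\ u n != t) -> u @ \oo --> t ->
  mu.-integrable setT (EFin \o D) /\
  ((fun n => (\int[mu]_x phi x (u n) - \int[mu]_x phi x t) / (u n - t))
    @ \oo --> \int[mu]_x D x).
Proof.
move=> u0 ut.
(* The Lipschitz bound holds only for times near [t], hence the shift by an [N] beyond which the
   sequence stays in that neighbourhood. *)
have [N _ HN] := ut _ phi_lip.
pose q n x := (phi x (u (n + N)%N) - phi x t) / (u (n + N)%N - t).
have q_int n : mu.-integrable setT (EFin \o q n).
  rewrite (_ : _ \o _ = fun x => ((u (n + N)%N - t)^-1%:E *
    ((EFin \o phi^~ (u (n + N)%N)) \- (EFin \o phi^~ t)) x)%E); last first.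
    by apply/funext => x; rewrite /= /q mulrC EFinM EFinB.
  apply: integrableZl => //; apply: integrableB => //; apply: phi_int => //.
  by have [] := u0 (n + N)%N.
have mq n : measurable_fun setT (q n).
  exact/measurable_EFinP/(measurable_int _ (q_int n)).
have qD x : q ^~ x @ \oo --> D x.
  have : (fun n => (phi x (u n) - phi x t) / (u n - t)) @ \oo --> D x.
    exact: (cvg_comp _ _ (time_nbhs_cvg t u u0 ut) (phi_derive x)).
  by rewrite -(cvg_shiftn N).
have mD : measurable_fun setT D.
  exact: (measurable_fun_cvg mq (fun x _ => qD x)).
have qDE : {ae mu, forall x, setT x ->
    (fun n => (EFin \o q n) x) @ \oo --> (EFin \o D) x}.
  by apply: aeW => x _; apply: cvg_EFin; [exact: nearW|exact: qD].
have qG : {ae mu, forall x n, setT x ->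
    (`|(EFin \o q n) x| <= (EFin \o G) x)%E}.
  (* The exceptional null set depends on the time; along a sequence there are only countably many of
     them. *)
  apply/ae_foralln => n.
  have [uN0 uNt] := u0 (n + N)%N.
  apply: filterS (HN (n + N)%N (leq_addl _ _) uN0) => x Hx _ /=.
  by rewrite lee_fin normrM normfV ler_pdivrMr// normr_gt0 subr_eq0.
have [iD _ cvgD] := @dominated_convergence _ _ _ mu setT measurableT
  (fun n => EFin \o q n) (EFin \o D) (EFin \o G)
  (fun n => (measurable_EFinP _ _).2 (mq n)) ((measurable_EFinP _ _).2 mD)
  qDE G_int qG.
split=> //; rewrite -(cvg_shiftn N).
have -> : (fun n => (\int[mu]_x phi x (u (n + N)%N) - \int[mu]_x phi x t) /
    (u (n + N)%N - t)) = (fun n => \int[mu]_x q n x).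
  apply/funext => n; have [uN0 uNt] := u0 (n + N)%N.
  rewrite -RintegralB//; [|exact: phi_int|exact: phi_int].
  rewrite mulrC -RintegralZl//; last first.
    exact: (integrableB _ (phi_int _ uN0) (phi_int t t_ge0)).
  by apply: eq_Rintegral => x _; rewrite /q mulrC.
apply: fine_cvg; rewrite fineK//; first exact: integrable_fin_num.
Qed.

Lemma integrable_derive_nneg : mu.-integrable setT (EFin \o D).
Proof.
(* Any admissible sequence yields integrability; this one approaches from the right, so it stays
   nonnegative even at [t = 0]. *)
apply: (quot_cvg (fun n => t + n.+1%:R^-1) _ _).1.
- by move=> n; split; rewrite ?addr_ge0// -subr_eq0 addrAC subrr add0r.
- rewrite -[X in _ --> X]addr0; apply: cvgD; first exact: cvg_cst.
  exact: cvg_harmonic.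
Qed.

Lemma is_derive_nneg_integral :
  is_derive_nneg (fun s => \int[mu]_x phi x s) t (\int[mu]_x D x).
Proof. by apply: time_nbhs_seqP => u u0 ut; exact: (quot_cvg u u0 ut).2. Qed.

End derive_under_integral.

(** * The weak form of the collision term *)

Section clamp.
Context {R : realType}.
Implicit Types a b x y : R.

Definition clamp a x : R := Num.max (- a) (Num.min x a).

(** Three cases given by linear relations, so that [lra] can settle the estimates below. *)
Lemma clampP a x : 0 <= a -> [\/ x <= - a /\ clamp a x = - a,
  [/\ - a <= x, x <= a & clamp a x = x] | a <= x /\ clamp a x = a].
Proof.
move=> a0; have aa : - a <= a by lra.
rewrite /clamp; case: (leP x a) => xa; last first.
  by apply: Or33; split; [exact: ltW|exact/max_idPr].
case: (leP (- a) x) => ax; first by apply: Or32.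
by apply: Or31; rewrite (ltW ax).
Qed.

Lemma normr_clamp_le a x : 0 <= a -> `|clamp a x| <= a.
Proof.
move=> a0; rewrite ler_norml; apply/andP.
by case: (clampP a x a0) => -[]*; lra.
Qed.

Lemma normr_clamp_ler a x : 0 <= a -> `|clamp a x| <= `|x|.
Proof.
move=> a0; have := ler_norm x; have := ler_norm (- x); rewrite normrN => h1 h2.
by rewrite ler_norml; apply/andP; case: (clampP a x a0) => -[]*; lra.
Qed.

Lemma clamp_id a x : `|x| <= a -> clamp a x = x.
Proof.
move=> xa; have a0 : 0 <= a := le_trans (normr_ge0 x) xa.
by move: xa; rewrite ler_norml => /andP[]; case: (clampP a x a0) => -[]*; lra.
Qed.

Lemma clamp_lip a x y : 0 <= a -> x <= y ->
  0 <= clamp a y - clamp a x <= y - x.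
Proof.
move=> a0 xy; apply/andP.
by case: (clampP a x a0) => -[]*; case: (clampP a y a0) => -[]*; lra.
Qed.

Lemma clamp_clamp a b x : 0 <= a -> a <= b -> clamp a (clamp b x) = clamp a x.
Proof.
move=> a0 ab; have b0 := le_trans a0 ab.
case: (clampP b x b0) => [[xb ->]|[_ _ ->//]|[bx ->]].
- by case: (clampP a x a0) => -[]*; case: (clampP a (- b) a0) => -[]*; lra.
- by case: (clampP a x a0) => -[]*; case: (clampP a b a0) => -[]*; lra.
Qed.

(** Clamping at [a] factors through clamping at [b], and [clamp a] is nondecreasing and 1-Lipschitz.
    This provides the monotonicity in the truncation level. *)
Lemma clamp_incr_le a b x y : 0 <= a -> a <= b -> x <= y ->
  0 <= clamp a y - clamp a x <= clamp b y - clamp b x.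
Proof.
move=> a0 ab xy; rewrite -(clamp_clamp a b x)// -(clamp_clamp a b y)//.
apply: clamp_lip => //; rewrite -subr_ge0.
by have /andP[] := clamp_lip b x y (le_trans a0 ab) xy.
Qed.

Lemma measurable_clamp a : measurable_fun setT (clamp a).
Proof. by apply: measurable_maxr => //; exact: measurable_minr. Qed.

End clamp.

(** * Symmetrization under jump reversal *)

Section symmetrization.
Context {R : realType} {d : nat}.
Local Notation V := 'rV[R]_d.
Local Notation mu := (lebesgue_rV d).
Local Notation P := (mu \x mu)%E.
Variables (s : R) (K : V * V -> R) (u : V -> R).
Hypothesis K_ge0 : forall z, 0 <= K z.
Hypothesis K_swap : forall z, K (jump_swap s z) = K z.
Hypothesis Ku_int : P.-integrable setT (fun z => (K z * u z.1)%:E).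

Local Notation target z := (z.1 + s *: z.2).

Lemma jump_swap_target (z : V * V) : target (jump_swap s z) = z.1.
Proof. by rewrite /= scalerN addrK. Qed.

Lemma integrable_jump_swap (h : V * V -> \bar R) :
  P.-integrable setT h -> P.-integrable setT (h \o jump_swap s).
Proof.
move=> /integrableP[mh hoo]; apply/integrableP; split.
  exact: measurableT_comp mh (measurable_jump_swap s).
rewrite (le_lt_trans _ hoo)//.
rewrite -(integral_jump_swap s (fun z => `|h z|)%E)//.
exact: measurableT_comp.
Qed.

Definition flux (z : V * V) : R := K z * (u (target z) - u z.1).

(* [fine] gives 0 on the null set where the integral is infinite. *)
Definition net_flux (x : V) : R := fine (\int[mu]_xi (flux (x, xi))%:E)%E.

Lemma flux_swap z : flux (jump_swap s z) = - flux z.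
Proof. by rewrite /flux K_swap jump_swap_target /= -mulrN opprB. Qed.

(** The gain term [K z * u (target z)] is the loss term [K z * u z.1] composed with the swap, so it
    inherits integrability from it. *)
Lemma integrable_flux : P.-integrable setT (EFin \o flux).
Proof.
have -> : EFin \o flux = ((fun z => (K z * u z.1)%:E) \o jump_swap s \-
    (fun z => (K z * u z.1)%:E))%E.
  by apply/funext => z; rewrite /= -EFinB K_swap -mulrBr.
by apply: integrableB => //; exact: integrable_jump_swap.
Qed.

Let mflux : measurable_fun setT flux.
Proof. by have /measurable_int/measurable_EFinP := integrable_flux. Qed.

Lemma measurable_net_flux : measurable_fun setT net_flux.
Proof.
exact: (measurableT_comp (@fine_measurable R setT measurableT)
  (measurable_fubini_F integrable_flux)).
Qed.

Lemma integrable_net_flux : mu.-integrable setT (EFin \o net_flux).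
Proof.
have iF := integrable_fubini_F integrable_flux.
apply/integrableP; split.
  apply/measurable_EFinP. exact: measurable_net_flux.
have /integrableP[mF Foo] := iF; apply: le_lt_trans Foo.
apply: ge0_le_integral => //.
- apply: measurableT_comp => //; apply/measurable_EFinP.
  exact: measurable_net_flux.
- exact: measurableT_comp.
(* Where the inner integral is infinite, [fine] returns 0, so the absolute value can only
   decrease. *)
- move=> x _; rewrite /= /net_flux -/(fubini_F mu (EFin \o flux) x).
  by case: (fubini_F _ _ _) => [r| |] //=; rewrite normr0 leey.
Qed.

(** * Bounded test functions *)

Section bounded.
Variables (L : V -> R) (M : R).
Hypothesis mL : measurable_fun setT L.
Hypothesis LM : forall x, `|L x| <= M.

Let mL1 : measurable_fun setT (fun z : V * V => L z.1).
Proof. exact: measurableT_comp mL measurable_fst. Qed.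

Let iL : P.-integrable setT (EFin \o (fun z => L z.1 * flux z)).
Proof.
apply: (@le_integrable _ _ _ _ _ _ _ (fun z => M%:E * (flux z)%:E)%E) => //.
- apply/measurable_EFinP; exact: measurable_funM.
- move=> z _; rewrite /= lee_fin !normrM ler_wpM2r//.
  exact: le_trans (LM _) (ler_norm _).
- by apply: integrableZl => //; exact: integrable_flux.
Qed.

Lemma Rintegral_net_flux :
  \int[mu]_x (L x * net_flux x) = \int[P]_z (L z.1 * flux z).
Proof.
congr fine; rewrite -(integral12_prod_meas1 iL).
apply: ae_eq_integral => //.
- by apply/measurable_EFinP/measurable_funM => //; exact: measurable_net_flux.
- exact: (measurable_fubini_F iL).
(* Almost every section of the flux is integrable; there [L x] leaves the inner integral and [fine]
   loses nothing. *)
- have := ae_integrable1 integrable_flux; apply: filterS => x ix _ /=.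
  rewrite /fubini_F /=.
  under [RHS]eq_integral do rewrite EFinM.
  rewrite integralZl// EFinM /net_flux fineK//.
  exact: integrable_fin_num ix.
Qed.

Lemma integrable_bounded_symm :
  P.-integrable setT (EFin \o (fun z => (L (target z) - L z.1) * flux z)).
Proof.
(* By antisymmetry of the flux, [L (target z) * flux z] is the opposite of [L z.1 * flux z] composed
   with the swap. *)
have iN := integrableN (integrable_jump_swap _ iL).
have := integrableB measurableT iN iL; apply: eq_integrable => // z _.
by rewrite /= flux_swap -?EFinN -?EFinB; congr EFin; ring.
Qed.

(** The swap makes the integral of [L (target z) * flux z] the opposite of that of [L z.1 * flux z],
    so their difference is [- 2] times the latter. The bound on [L] keeps both finite, so that they
    may be subtracted. *)
Lemma Rintegral_bounded_symm :
  \int[P]_z ((L (target z) - L z.1) * flux z) =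
  - 2 * \int[mu]_x (L x * net_flux x).
Proof.
rewrite Rintegral_net_flux.
have iLS := integrable_jump_swap _ iL.
have E : \int[P]_z (L (target z) * flux z) = - \int[P]_z (L z.1 * flux z).
  have -> : \int[P]_z (L z.1 * flux z) =
      \int[P]_z (L (target z) * flux (jump_swap s z)).
    congr fine.
    rewrite -(integral_jump_swap s (fun z => (L z.1 * flux z)%:E))//.
    apply/measurable_EFinP; exact: measurable_funM.
  rewrite -mulN1r -RintegralZl//.
  by apply: eq_Rintegral => z _; rewrite flux_swap; ring.
have -> : - 2 * \int[P]_z (L z.1 * flux z) =
    \int[P]_z (L (target z) * flux z) - \int[P]_z (L z.1 * flux z).
  by rewrite E; ring.
rewrite -RintegralB//.
  by apply: eq_Rintegral => z _; rewrite mulrBl.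
apply: eq_integrable (integrableN iLS) => // z _.
by rewrite /= flux_swap -?EFinN; congr EFin; ring.
Qed.

End bounded.

(** * Unbounded test functions that increase with the density ratio *)

Section comonotone.
Variable L : V -> R.
Hypothesis mL : measurable_fun setT L.
Hypothesis L_homo : forall x y, u x <= u y -> L x <= L y.
Hypothesis LQ_int : mu.-integrable setT (EFin \o (fun x => L x * net_flux x)).

Let Ln n x := clamp n%:R (L x).
Let D (z : V * V) := (L (target z) - L z.1) * flux z.
Let Dn n (z : V * V) := (Ln n (target z) - Ln n z.1) * flux z.

Let mLn n : measurable_fun setT (Ln n).
Proof. exact: measurableT_comp (measurable_clamp _) mL. Qed.

Let mdiff (g : V -> R) : measurable_fun setT g ->
  measurable_fun setT (fun z : V * V => (g (target z) - g z.1) * flux z).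
Proof.
move=> mg; apply: measurable_funM => //; apply: measurable_funB.
- exact: measurableT_comp mg (measurable_jump s).
- exact: measurableT_comp mg measurable_fst.
Qed.

Let Dn_le m n z : (m <= n)%N -> 0 <= Dn m z <= Dn n z.
Proof.
move=> mn; rewrite /Dn /flux.
have mn' : m%:R <= n%:R :> R by rewrite ler_nat.
have [uu|/ltW uu] := leP (u z.1) (u (target z)).
  have w0 : 0 <= K z * (u (target z) - u z.1) by rewrite mulr_ge0// subr_ge0.
  have /andP[c0 c1] := clamp_incr_le _ _ _ _ (ler0n R m) mn' (L_homo _ _ uu).
  by rewrite mulr_ge0// ler_wpM2r.
have w0 : 0 <= K z * (u z.1 - u (target z)) by rewrite mulr_ge0// subr_ge0.
(* When [u] decreases along the jump, both factors change sign together, which leads back to the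
   previous case. *)
have E k : (Ln k (target z) - Ln k z.1) * (K z * (u (target z) - u z.1)) =
    (Ln k z.1 - Ln k (target z)) * (K z * (u z.1 - u (target z))) by ring.
have /andP[c0 c1] := clamp_incr_le _ _ _ _ (ler0n R m) mn' (L_homo _ _ uu).
by rewrite !E mulr_ge0// ler_wpM2r.
Qed.

Let LnE (x : R) : \forall n \near \oo, clamp n%:R x = x.
Proof.
near=> n; apply: clamp_id; near: n; exact: nbhs_infty_ger.
Unshelve. all: by end_near. Qed.

Let DnE z : \forall n \near \oo, Dn n z = D z.
Proof.
near=> n; rewrite /Dn /Ln; congr ((_ - _) * _).
- by near: n; exact: LnE.
- by near: n; exact: LnE.
Unshelve. all: by end_near. Qed.

(** Clamping does not increase absolute values, so [L x * net_flux x] dominates its truncations,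
    which are eventually equal to it at each point. *)
Let cvg_Rintegral_Ln :
  (fun n => \int[mu]_x (Ln n x * net_flux x)) @ \oo -->
  \int[mu]_x (L x * net_flux x).
Proof.
have mQ := measurable_net_flux.
pose h x := (L x * net_flux x)%:E.
pose hn n x := (Ln n x * net_flux x)%:E.
have mhn n : measurable_fun setT (hn n).
  by apply/measurable_EFinP; exact: measurable_funM.
have cv : {ae mu, forall x, setT x -> (fun n => hn n x) @ \oo --> h x}.
  apply: aeW => x _; apply: cvg_near_cst; near=> n; rewrite /hn /Ln.
  by congr (_ * _)%:E; near: n; exact: LnE.
have bd : {ae mu, forall x n, setT x -> (`|hn n x| <= (abse \o h) x)%E}.
  apply: aeW => x n _.
  by rewrite /= lee_fin !normrM ler_wpM2r// normr_clamp_ler.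
have [_ _ cvI] := dominated_convergence measurableT mhn
  (measurable_int _ LQ_int) cv (integrable_abse LQ_int) bd.
by apply: fine_cvg; rewrite fineK//; exact: integrable_fin_num.
Unshelve. all: by end_near. Qed.

(** The left-hand side stays in the extended reals: monotone convergence identifies it as a limit of
    truncated integrals, and its finiteness is then read off from the right-hand side. *)
Lemma integral_comonotone_symm :
  (\int[P]_z ((L (target z) - L z.1) * flux z)%:E =
   (- 2 * \int[mu]_x (L x * net_flux x))%:E)%E.
Proof.
have bLn n x : `|Ln n x| <= n%:R by exact: normr_clamp_le.
have cvD : (fun n => \int[P]_z (Dn n z)%:E)%E @ \oo --> (\int[P]_z (D z)%:E)%E.
  have -> : (\int[P]_z (D z)%:E = \int[P]_z limn (fun n => (Dn n z)%:E))%E.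
    apply: eq_integral => z _; apply/esym/cvg_lim => //.
    by apply: cvg_near_cst; near=> n; congr EFin; near: n; exact: DnE.
  apply: cvg_monotone_convergence => //.
  - by move=> n; apply/measurable_EFinP; exact: mdiff.
  - by move=> n z _; rewrite lee_fin; have /andP[] := Dn_le n n z (leqnn n).
  - by move=> z _ m n mn; rewrite lee_fin; have /andP[] := Dn_le m n z mn.
rewrite -(cvg_lim _ cvD)//; apply/cvg_lim => //.
have -> : (fun n => \int[P]_z (Dn n z)%:E)%E =
    EFin \o (fun n => - 2 * \int[mu]_x (Ln n x * net_flux x)).
  apply/funext => n; rewrite /= -(Rintegral_bounded_symm _ _ (mLn n) (bLn n)).
  rewrite fineK//; apply: integrable_fin_num => //.
  exact: integrable_bounded_symm (mLn n) (bLn n).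
by apply: cvg_EFin; [exact: nearW|apply: cvgM => //; exact: cvg_cst].
Unshelve. all: by end_near. Qed.

End comonotone.
End symmetrization.

(** * Entropy production *)

Section kinetic_flux.
Context {R : realType} {d : nat}.
Local Notation V := 'rV[R]_d.
Local Notation mu := (lebesgue_rV d).
Local Notation P := (mu \x mu)%E.
Variables (m p g : V -> R) (s : R).
Hypothesis mm : measurable_fun setT m.
Hypothesis m_gt0 : forall x, 0 < m x.
Hypothesis p_density : is_density p.
Hypothesis p_sym : forall xi, p (- xi) = p xi.
Hypothesis g_density : is_density g.
Hypothesis g_gt0 : forall x, 0 < g x.

Local Notation target z := (z.1 + s *: z.2).

Definition detailed_balance_kernel (z : V * V) : R :=
  Num.min (m z.1) (m (target z)) * p z.2.

Local Notation K := detailed_balance_kernel.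
Local Notation u := (fun x => g x / m x).

Let mp : measurable_fun setT p. Proof. by have [] := p_density. Qed.
Let p_ge0 xi : 0 <= p xi. Proof. by have [] := p_density. Qed.
Let mg : measurable_fun setT g. Proof. by have [] := g_density. Qed.
Let g_ge0 x : 0 <= g x. Proof. exact: ltW. Qed.

Let mtarget : measurable_fun setT (fun z : V * V => target z).
Proof. exact: measurable_jump. Qed.

Let mmin : measurable_fun setT
  (fun z : V * V => Num.min (m z.1) (m (target z))).
Proof.
apply: measurable_minr; first exact: measurableT_comp mm measurable_fst.
exact: measurableT_comp mm mtarget.
Qed.

Lemma measurable_detailed_balance_kernel : measurable_fun setT K.
Proof.
apply: measurable_funM => //; exact: measurableT_comp mp measurable_snd.
Qed.

Lemma detailed_balance_kernel_ge0 z : 0 <= K z.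
Proof. by rewrite mulr_ge0// le_min !ltW. Qed.

Lemma detailed_balance_kernel_swap z : K (jump_swap s z) = K z.
Proof. by rewrite /K jump_swap_target /= p_sym minC. Qed.

Lemma measurable_density_ratio : measurable_fun setT u.
Proof.
(* As [m] is positive, its inverse is an exponential of a logarithm, both measurable functions. *)
have -> : u = (fun x => g x * expR (- ln (m x))).
  by apply/funext => x; rewrite expRN lnK// posrE.
apply: measurable_funM => //.
apply: (measurableT_comp (@measurable_expR R)).
exact: measurable_funN (measurableT_comp (@measurable_ln R) mm).
Qed.

Let mu_u := measurable_density_ratio.

Let u_gt0 x : 0 < u x. Proof. exact: divr_gt0. Qed.

(** Bounding the minimum by [m z.1] gives [K z * u z.1 <= g z.1 * p z.2], a product of two
    probability densities. *)
Lemma integrable_kernel_ratio : P.-integrable setT (fun z => (K z * u z.1)%:E).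
Proof.
have mgp : measurable_fun setT (fun z : V * V => g z.1 * p z.2).
  apply: measurable_funM; first exact: measurableT_comp mg measurable_fst.
  exact: measurableT_comp mp measurable_snd.
have gp_int : P.-integrable setT (EFin \o (fun z : V * V => g z.1 * p z.2)).
  apply/integrable12ltyP; first exact/measurable_EFinP.
  under eq_integral => x _.
    under eq_integral => y _ do rewrite /= ger0_norm ?mulr_ge0// EFinM.
    rewrite ge0_integralZl//; [|exact/measurable_EFinP
      |by move=> y _; rewrite lee_fin|by rewrite lee_fin].
    have [_ _ ->] := p_density; rewrite mule1.
    over.
  by have [_ _ ->] := g_density; rewrite ltry.
apply: le_integrable gp_int => //.
  apply/measurable_EFinP; apply: measurable_funM.
    exact: measurable_detailed_balance_kernel.
  exact: measurableT_comp mu_u measurable_fst.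
move=> z _; have Ku0 : 0 <= K z * u z.1.
  by rewrite mulr_ge0 ?detailed_balance_kernel_ge0// ltW.
rewrite /= lee_fin (ger0_norm Ku0) ger0_norm ?mulr_ge0//.
rewrite /K mulrAC ler_wpM2r// mulrA ler_pdivrMr// mulrC ler_wpM2l//.
by rewrite ge_min lexx.
Qed.

(** The right-hand side is symmetric in [x] and [y]: this is detailed balance for the Metropolis
    rate. *)
Lemma transitionE (x y : V) : transition m x y * m x = Num.min (m x) (m y).
Proof.
rewrite /transition; have m0 := m_gt0 x.
case: (leP 1 (m y / m x)) => h; rewrite ?mul1r ?divfK ?gt_eqF//.
- by move: h; rewrite ler_pdivlMr// mul1r => /min_idPl ->.
- by move: h; rewrite ltr_pdivrMr// mul1r => /ltW/min_idPr ->.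
Qed.

(** Once [g] is written as [m] times [u], gain and loss carry the same rate by detailed balance, and
    the increment of [u] factors out. *)
Lemma collisionE x :
  collision m p s g x = (\int[mu]_xi (flux s K u (x, xi))%:E)%E.
Proof.
apply: eq_integral => xi _; rewrite -EFinM; congr EFin; rewrite /flux /K /=.
set x' := x + s *: xi.
have {1}-> : g x' = m x' * u x' by rewrite mulrC divfK ?gt_eqF.
have {1}-> : g x = m x * u x by rewrite mulrC divfK ?gt_eqF.
by rewrite !mulrA !transitionE (minC (m x')); ring.
Qed.

Lemma net_fluxE x : net_flux s K u x = fine (collision m p s g x).
Proof. by rewrite collisionE. Qed.

Lemma hfun_ge0 (a b : R) : 0 < a -> 0 < b -> 0 <= hfun a b.
Proof.
move=> a0 b0; rewrite /hfun; case: (leP a b) => [ab|/ltW ab].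
  by rewrite mulr_le0// subr_le0 ?ler_ln.
by rewrite mulr_ge0// subr_ge0 ?ler_ln.
Qed.

(** The kernel times [hfun] is nonnegative, so Tonelli applies whether or not the integral is
    finite. The noise is the outer variable in [entropy_production], hence the second order of
    integration. *)
Lemma entropy_productionE :
  (entropy_production m p s g = (2^-1)%:E *
   \int[P]_z ((ln (u (target z)) - ln (u z.1)) * flux s K u z)%:E)%E.
Proof.
pose B (z : V * V) := Num.min (m z.1) (m (target z)) *
  hfun (u (target z)) (u z.1).
have mut : measurable_fun setT (fun z : V * V => u (target z)).
  exact: measurableT_comp mu_u mtarget.
have mu1 : measurable_fun setT (fun z : V * V => u z.1).
  exact: measurableT_comp mu_u measurable_fst.
have mB : measurable_fun setT B.
  apply: measurable_funM => //; apply: measurable_funM.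
    exact: measurable_funB.
  by apply: measurable_funB; exact: measurableT_comp (@measurable_ln R) _.
have B0 z : 0 <= B z by rewrite mulr_ge0 ?hfun_ge0// le_min !ltW.
congr (_ * _)%E.
have -> : (\int[P]_z ((ln (u (target z)) - ln (u z.1)) * flux s K u z)%:E =
    \int[P]_z (B z * p z.2)%:E)%E.
  by apply: eq_integral => z _; congr EFin; rewrite /B /flux /K /hfun; ring.
rewrite fubini_tonelli2//; last 2 first.
- apply/measurable_EFinP; apply: measurable_funM => //.
  exact: measurableT_comp mp measurable_snd.
- by move=> z; rewrite lee_fin mulr_ge0.
apply: eq_integral => xi _; rewrite /fubini_G.
transitivity (\int[mu]_x ((B (x, xi))%:E * (p xi)%:E))%E; last first.
  by apply: eq_integral => x _; rewrite -EFinM.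
rewrite ge0_integralZr//.
- by congr (_ * _)%E; apply: eq_integral => x _; rewrite transitionE.
- apply/measurable_EFinP; exact: measurableT_comp mB (pair2_measurable _).
- by move=> x _; rewrite lee_fin.
- by rewrite lee_fin.
Qed.

(** Conservation of mass: the weak form tested against the constant 1, whose increments vanish. *)
Lemma Rintegral_net_flux0 : \int[mu]_x net_flux s K u x = 0.
Proof.
have one_le (x : V) : `|cst (1 : R) x| <= 1 by rewrite normr1.
have := Rintegral_bounded_symm s K u detailed_balance_kernel_swap
  integrable_kernel_ratio (cst 1) 1 (measurable_cst _) one_le.
under eq_Rintegral do rewrite /= subrr mul0r.
under [in RHS]eq_Rintegral do rewrite /= mul1r.
rewrite /Rintegral integral0 /=; lra.
Qed.

Lemma entropy_production_net_flux :
  mu.-integrable setT (EFin \o (fun x => (ln (u x) + 1) * net_flux s K u x)) ->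
  (entropy_production m p s g =
   (- \int[mu]_x ((ln (u x) + 1) * net_flux s K u x))%:E)%E.
Proof.
move=> iD.
have iQ := integrable_net_flux s K u detailed_balance_kernel_swap
  integrable_kernel_ratio.
have iL : mu.-integrable setT (EFin \o (fun x => ln (u x) * net_flux s K u x)).
  apply: eq_integrable (integrableB measurableT iD iQ) => // x _.
  by rewrite /= -EFinB; congr EFin; ring.
have u_homo x y : u x <= u y -> ln (u x) <= ln (u y).
  by rewrite ler_ln// posrE.
have mlnu : measurable_fun setT (fun x => ln (u x)).
  exact: measurableT_comp (@measurable_ln R) mu_u.
rewrite entropy_productionE (integral_comonotone_symm s K u
  detailed_balance_kernel_ge0 detailed_balance_kernel_swap
  integrable_kernel_ratio _ mlnu u_homo iL).
rewrite -EFinM; congr EFin.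
have -> : \int[mu]_x ((ln (u x) + 1) * net_flux s K u x) =
    \int[mu]_x (ln (u x) * net_flux s K u x) + \int[mu]_x net_flux s K u x.
  by rewrite -RintegralD//; apply: eq_Rintegral => x _; rewrite mulrDl mul1r.
(* The factor 1/2 of the production meets the [- 2] of the weak form, and the term [+ 1] contributes
   only the vanishing total flux. *)
by rewrite Rintegral_net_flux0; field.
Qed.

Lemma entropy_production_ge0 : (0 <= entropy_production m p s g)%E.
Proof.
apply: mule_ge0; first by rewrite lee_fin invr_ge0.
apply: integral_ge0 => xi _; rewrite mule_ge0 ?lee_fin//.
apply: integral_ge0 => x _; rewrite lee_fin /= transitionE.
by rewrite mulr_ge0 ?hfun_ge0// le_min !ltW.
Qed.

End kinetic_flux.

(** With [c] the Gibbs density at a point, this differentiates the entropy density with respect to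
    the value of [f] there, ready for the chain rule in time. *)
Lemma is_derive_mul_ln_div {R : realType} (c y : R) : 0 < c -> 0 < y ->
  is_derive y 1 (fun z => z * ln (z / c)) (ln (y / c) + 1).
Proof.
move=> c0 y0.
have h1 : is_derive y 1 (fun z => z / c) c^-1.
  have -> : (fun z => z / c) = c^-1 *: (@id R).
    by apply/funext => z; rewrite mulrC.
  by apply: is_derive_eq; rewrite /GRing.scale /= mulr1.
have h2 : is_derive (y / c) 1 (@ln R) (y / c)^-1.
  by apply: is_derive1_ln; exact: divr_gt0.
have h3 := @is_derive1_comp _ (@ln R) (fun z => z / c) y _ _ h2 h1.
apply: (@is_derive_eq _ _ _ _ _ _ _ _ (is_deriveM (is_derive_id y 1) h3)).
rewrite /GRing.scale /=; field.
by rewrite !gt_eqF.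
Qed.

(** * Dissipation of the relative entropy *)

Theorem theorem3p1 (R : realType) (d : nat) (d_gt0 : (0 < d)%N)
    (F : 'rV[R]_d -> R) (T C : R) (p : 'rV[R]_d -> R) (sigma : R -> R)
    (f : 'rV[R]_d -> R -> R)
    (F_min : exists! x0, forall x, F x0 <= F x)
    (T_gt0 : 0 < T)
    (C_norm : is_density (gibbs F T C))
    (p_density : is_density p)
    (p_sym : forall xi, p (- xi) = p xi)
    (p_mean : mean0 p)
    (p_cov : covariance_id p)
    (sigma_gt0 : forall t, 0 <= t -> 0 < sigma t)
    (f_sol : kinetic_solution (gibbs F T C) p sigma f)
    (f_gt0 : forall x t, 0 <= t -> 0 < f x t)
    (f_reg : entropy_regular (gibbs F T C) f)
    (t : R) (t_ge0 : 0 <= t) :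
  let I := entropy_production (gibbs F T C) p (sigma t) (f^~ t) in
  [/\ I \is a fin_num,
      is_derive_nneg (fun s => relative_entropy (gibbs F T C) (f^~ s)) t
        (- fine I)
    & - fine I <= 0].
Proof.
set m := gibbs F T C in C_norm f_sol f_reg *.
move=> I.
have [mm m_ge0 m_int] := C_norm.
(* Nonnegativity of the Gibbs density forces [C >= 0], and [C = 0] would give total mass 0 instead
   of 1. *)
have m_gt0 x : 0 < m x.
  rewrite mulr_gt0 ?expR_gt0// lt0r.
  rewrite -(pmulr_lge0 _ (expR_gt0 (- F x / T))) m_ge0.
  rewrite andbT; apply/eqP => C0.
  have : (\int[lebesgue_rV d]_x (m x)%:E = 0)%E.
    by apply: integral0_eq => z _; rewrite /m /gibbs C0 mul0r.
  by rewrite m_int => /eqP; rewrite eqe oner_eq0.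
have g_density s : 0 <= s -> is_density (f^~ s) by move=> /f_sol[].
have [_ [G G_int f_lip]] := f_reg t t_ge0.
pose Q := net_flux (sigma t) (detailed_balance_kernel m p (sigma t))
  (fun x => f x t / m x).
pose D x := (ln (f x t / m x) + 1) * Q x.
pose phi x s := entropy_density m (f^~ s) x.
(* Chain rule along the kinetic equation: the time derivative of [f x] is the collision term, which
   is [Q x]. *)
have phi_derive x : is_derive_nneg (phi x) t (D x).
  have [_ /(_ x)[_ fx]] := f_sol t t_ge0.
  have psi := is_derive_mul_ln_div _ _ (m_gt0 x) (f_gt0 x t t_ge0).
  have := is_derive_nneg_comp _ _ _ _ _ fx psi.
  by rewrite /D /Q net_fluxE// => y; exact: f_gt0.
have phi_int s : 0 <= s -> (lebesgue_rV d).-integrable setT (EFin \o phi^~ s).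
  by move=> /f_reg[].
have D_int := integrable_derive_nneg _ phi D G t t_ge0 phi_int phi_derive G_int
  f_lip.
have D_derive := is_derive_nneg_integral _ phi D G t t_ge0 phi_int phi_derive
  G_int f_lip.
have ft_gt0 x : 0 < f x t by exact: f_gt0.
(* Integrability of [D], obtained from the Lipschitz bound, is what makes the production a real
   number. *)
have IE : I = (- \int[lebesgue_rV d]_x D x)%:E.
  exact: (entropy_production_net_flux m p (f^~ t) (sigma t) mm m_gt0 p_density
    p_sym (g_density t t_ge0) ft_gt0 D_int).
split; first by rewrite IE.
- by rewrite IE /= opprK.
- by rewrite oppr_le0 fine_ge0// entropy_production_ge0.
Qed.
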